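(* There exists a family $\mathcal{F}_\varrho\subseteq[\omega_1]^{<\omega}$ of finite subsets of $\omega_1$ such that its closure $\mathcal{K}_\varrho:=\overline{\mathcal{F}_\varrho}$ in $\mathcal{P}(\omega_1)$ has the following properties: (i) $\{\alpha\}\in\mathcal{K}_\varrho$ for every $\alpha<\omega_1$; (ii) $[0,\alpha)\in\mathcal{K}_\varrho$ for every $\alpha\leq\omega_1$; (iii) if $A\in\mathcal{K}_\varrho$ is an infinite set, then $A=[0,\alpha)$ for some $\alpha\leq\omega_1$; (iv) $\mathcal{K}_\varrho$ is scattered.
   Context: $\omega_1$ is the first uncountable ordinal, $[\omega_1]^{<\omega}$ is the set of finite subsets of $\omega_1$, and $[0,\alpha)=\{\gamma\colon 0\leq\gamma<\alpha\}$. The power set $\mathcal{P}(\omega_1)$ is identified with $\{0,1\}^{\omega_1}$ via $A\leftrightarrow 1_A$ and carries the corresponding (compact) product topology; closures and topological properties refer to this topology. A topological space is scattered if each of its non-empty closed subspaces has an isolated point. *)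

(* Defs.v *)
From HB Require Import structures.
From mathcomp Require Import all_boot all_order.
From mathcomp Require Import all_classical wochoice topology.

Set Implicit Arguments.
Unset Strict Implicit.
Unset Printing Implicit Defensive.

Import Order.TTheory.

Local Open Scope classical_set_scope.
Local Open Scope order_scope.

(* The order type of the first uncountable ordinal. These conditions determine
   [W] up to a unique order isomorphism; [omega1_exists] provides a model. *)
Definition is_omega1 (d : Order.disp_t) (W : orderType d) : Prop :=
  [/\ well_order (<=%O : rel W),
      ~ countable [set: W] &
      forall a : W, countable [set x : W | x < a]].

(* The ordinals alpha <= omega_1 are coded by [option W]: [Some a] is a
   countable ordinal and [None] is omega_1, so that [initseg None] is all
   of [W]. *)
Definition initseg (d : Order.disp_t) (W : orderType d) (a : option W) : set W :=
  if a is Some b then [set x | x < b] else setT.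

(* The identification A <-> 1_A of the power set with {0,1}^W, where [bool]
   carries its discrete topology and [{ptws W -> bool}] the product one. *)
Definition char (W : Type) (A : set W) : {ptws W -> bool} := fun x => x \in A.

(* The subspace [K] is scattered: the sets [K `&` D] with [D] closed in [X] are
   the closed subsets of the subspace [K]. *)
Definition scattered (X : topologicalType) (K : set X) : Prop :=
  forall D : set X, closed D -> K `&` D !=set0 ->
    exists x, isolated (K `&` D) x.

Lemma char_bij (W : Type) : bijective (@char W).
Proof.
exists (fun f : W -> bool => [set x | f x]) => [A|f].
  by apply/seteqP; split => x; rewrite /char /= inE.
by apply/funext => x; apply/idP/idP; rewrite /char inE.
Qed.

Lemma uncountable_nat_bool : ~ countable [set: nat -> bool].
Proof.
move=> /countable_injP[f finj].
pose g n := ~~ `[< exists2 h, f h = n & h n >].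
have gP : g (f g) = ~~ g (f g).
  rewrite {1}/g; congr (~~ _); apply/asboolP/idP => [[h /finj ->//]|gg];
    by [rewrite inE | exists g].
by move: gP; case: (g (f g)).
Qed.

Lemma restrict_well_order (T : choiceType) (R : rel T) (P : pred T) :
  well_order R ->
  exists W : orderType Order.default_display, exists v : W -> T,
    [/\ injective v, forall x, P x <-> exists w, v w = x,
        forall x y, (x <= y) = R (v x) (v y) & well_order (<=%O : rel W)].
Proof.
move=> Rwo; pose S := {x : T | P x}; pose le : rel S := relpre val R.
have Rwc : wo_chain R predT by move=> A _; exact: Rwo.
have Rtot x y : R x y || R y x by exact: (wo_chainW Rwc).
have Ranti x y : R x y && R y x -> x = y by exact: (wo_chain_antisymmetric Rwc).
have Rtr : transitive R.
  move=> y x z Rxy Ryz.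
  have [|m [[mA mlb] _]] := Rwo [pred u | u \in [:: x; y; z]].
    by exists x; rewrite !inE eqxx.
  have mx : R m x by apply: mlb; rewrite !inE eqxx.
  have my : R m y by apply: mlb; rewrite !inE eqxx orbT.
  have mz : R m z by apply: mlb; rewrite !inE eqxx !orbT.
  move: mA; rewrite !inE => /or3P[] /eqP mE; subst m => //.
    by rewrite (Ranti x y)// Rxy.
  by rewrite -(Ranti y z)// Ryz.
have le_refl : reflexive le by move=> x; rewrite /le /=; case/orP: (Rtot (val x) (val x)).
have le_anti : antisymmetric le by move=> x y xy; apply/val_inj/Ranti.
have le_trans : transitive le by move=> y x z; exact: Rtr.
have le_tot : total le by move=> x y; exact: Rtot.
pose m1 := Order.Le_isPOrder.Build Order.default_display S le_refl le_anti le_trans.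
pose PW : porderType _ := HB.pack S m1.
have tot' : total (<=%O : rel PW) by [].
pose m2 := Order.POrder_isTotal.Build _ PW tot'.
pose W : orderType Order.default_display := HB.pack S m1 m2.
exists W, (val : S -> T); split => //.
- by move=> x; split=> [Px|[w <-]]; [exists (exist _ x Px : S)|exact: (valP (w : S))].
- apply: antisymmetric_well_order => [x y|A [a aA]]; first exact: le_anti.
  pose B : {pred T} := fun t => `[< exists2 w : S, A w & val w = t >].
  have [|m [[/asboolP[w Aw wm] mlb] _]] := Rwo B.
    by exists (val (a : S)); apply/asboolP; exists a.
  exists w; split=> // u Au; rewrite /Order.le /= /le /= wm.
  by apply: mlb; apply/asboolP; exists u.
Qed.

Lemma omega1_exists :
  exists (d : Order.disp_t) (W : orderType d), is_omega1 W.
Proof.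
pose T : choiceType := nat -> bool.
have [R Rwo] := well_ordering_principle T.
have Runc : ~ countable [set: T] := uncountable_nat_bool.
pose bad : {pred T} := fun a => `[< ~ countable [set x | R x a && (x != a)] >].
have Rwc : wo_chain R predT by move=> A _; exact: Rwo.
have Ranti x y : R x y && R y x -> x = y by exact: (wo_chain_antisymmetric Rwc).
have [P [Punc Pseg]] : exists P : pred T, ~ countable [set x | P x] /\
    forall a, P a -> countable [set x | R x a && (x != a)].
  have [[a0 a0b]|nobad] := pselect (nonempty bad).
    have [|a [[/asboolP aunc alb] _]] := Rwo bad; first by exists a0.
    exists (fun x => R x a && (x != a)); split=> // b /andP[Rba /eqP ba].
    apply: contrapT => bunc; apply: ba; apply: Ranti; rewrite Rba /=.
    by apply: alb; apply/asboolP.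
  exists xpredT; split => [|a _].
    by apply: contra_not Runc; apply: sub_countable; exact: subset_card_le.
  by apply: contrapT => aunc; apply: nobad; exists a; apply/asboolP.
have [W [v [vinj vP vle Wwo]]] := restrict_well_order P Rwo.
exists Order.default_display, W; split=> // [Wc|a].
  apply: Punc; have -> : [set x | P x] = v @` setT.
    apply/seteqP; split=> x /=; first by move/vP => [w <-]; exists w.
    by move=> [w _ <-]; apply/vP; exists w.
  exact: sub_countable (card_image_le _ _) Wc.
have Pva : P (v a) by apply/vP; exists a.
have vseg : ([set x | x < a] #= (v @` [set x | x < a]))%card.
  by apply/card_esym/inj_card_eq => x y _ _ /vinj.
rewrite (eq_countable vseg); apply: sub_countable (Pseg _ Pva).
apply: subset_card_le => _ [x /= xa <-] /=.
by rewrite -vle (ltW xa) (inj_eq vinj) lt_eqF.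
Qed.

(* Main.v *)
Require Import Defs.
From mathcomp Require Import all_boot all_order.
From mathcomp Require Import all_classical topology.
From mathcomp Require Import wochoice zify.

(** The family consists of the singletons and of finite approximations P_n(a)
    of the initial segments [0,a), with four properties: P_n(a) is a subset of
    [0,a); every x < a belongs to P_n(a) for all large n; x in P_n(a) implies
    that P_n(x) is a subset of P_n(a); and P_n(a) has at most n elements.

    Fix b < a and let N be such that b is in P_m(a) for all m >= N. If P_n(c)
    contains a but not b, then P_n(c), containing P_n(a), forces n < N, so that
    P_n(c) has fewer than N elements. Hence every member of the family that
    contains a and omits b has size at most a bound depending on a and b only.
    Such a bound concerns finitely many coordinates at a time, so it passes to
    the closure K ([gap_bounded_closure]), and everything follows from it.
    An infinite element of K cannot have a gap b < a, so it is an initial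
    segment. For scatteredness, take a non-empty subspace L of K. If some
    element of L has a gap b < a, an element of maximal size among those
    containing a and omitting b is isolated ([isolated_gap]). Otherwise L is a
    chain of initial segments and its least element is isolated
    ([isolated_chain]). The sets P_n(a) converge to [0,a), and the segments
    [0,a) converge to the whole space because every finite set is bounded.

    The approximations are built by transfinite recursion, in
    [transitive_approximation]. Enumerating [0,a) as x_0, x_1, ..., let P_n(a)
    be the union of the sets {x_i} and P_n(x_i) for i < k(n). Transitivity is
    automatic, and the size is controlled by letting k(n) grow slowly. The
    bound n alone would not survive the recursion, as two elements may already
    have about 2n predecessors together; the invariant is instead that the
    size of P_n(x) is o(n) for every x, which leaves room for k(n) to tend to
    infinity and reproduces itself at a. *)

Import Order.TTheory.

Local Open Scope classical_set_scope.
Local Open Scope order_scope.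

(** * Sublinear growth *)

(** This is s(n) = o(n), in a form free of division. *)
Definition sublinear (s : nat -> nat) : Prop :=
  forall c : nat, exists N : nat, forall n : nat, (N <= n -> c * s n <= n)%N.

Lemma sublinear0 : sublinear (fun=> 0%N).
Proof. by move=> c; exists 0%N => n _; rewrite muln0. Qed.

Lemma sublinearSD (s t : nat -> nat) :
  sublinear s -> sublinear t -> sublinear (fun n => (s n + t n).+1).
Proof.
move=> ss st c; have [M sM] := ss (3 * c)%N; have [N tN] := st (3 * c)%N.
exists (maxn (maxn M N) (3 * c)) => n; rewrite !geq_max => /andP[/andP[]].
by move=> /sM sn /tN tn cn; lia.
Qed.

(** Finite sets are represented by lists with possible repetitions: only upper
    bounds on their sizes matter. *)
Definition cone {T : Type} (P : T -> nat -> seq T) (n : nat) (s : seq T) :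
  seq T := flatten [seq x :: P x n | x <- s].

Lemma mem_cone (T : eqType) (P : T -> nat -> seq T) (n : nat) (s : seq T)
    (y : T) :
  (y \in cone P n s) = has (fun x => (y == x) || (y \in P x n)) s.
Proof.
by elim: s => //= x s IHs; rewrite /cone /= inE mem_cat -orbA -IHs orbA.
Qed.

Lemma eq_in_cone (T : eqType) (P Q : T -> nat -> seq T) (n : nat) (s : seq T) :
  {in s, P =1 Q} -> cone P n s = cone Q n s.
Proof.
by move=> PQ; congr flatten; apply/eq_in_map => x /PQ ->.
Qed.

Lemma sublinear_cone (T : eqType) (P : T -> nat -> seq T) (s : seq T) :
  {in s, forall x, sublinear (fun n => size (P x n))} ->
  sublinear (fun n => size (cone P n s)).
Proof.
elim: s => [|x s IHs] sP; first exact: sublinear0.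
rewrite /cone /=; under eq_fun do rewrite size_cat.
apply: sublinearSD; first by apply: sP; rewrite mem_head.
by apply: IHs => y ys; apply: sP; rewrite inE ys orbT.
Qed.

(** The constraint asks that [g k n] be at most [n / k]; using [k] again as the
    factor is what makes the chosen value small compared with [n] as soon as
    [k] tends to infinity. *)
Definition stage (g : nat -> nat -> nat) (n : nat) : nat :=
  (\max_(k < n.+1 | k * g k n <= n) k)%N.

Lemma stage_le (g : nat -> nat -> nat) (n : nat) :
  (stage g n * g (stage g n) n <= n)%N.
Proof.
by rewrite /stage; elim/big_ind: _ => // i j; rewrite /maxn; case: ifP.
Qed.

Lemma stage_unbounded (g : nat -> nat -> nat) (k : nat) :
  sublinear (g k) -> exists N : nat, forall n, (N <= n -> k <= stage g n)%N.
Proof.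
move=> /(_ k)[N gN]; exists (maxn N k) => n; rewrite geq_max => /andP[/gN kn].
by rewrite -ltnS => kn1; exact: (leq_bigmax_cond (Ordinal kn1)).
Qed.

Definition slow_cone {T : Type} (P : T -> nat -> seq T) (E : nat -> seq T)
    (n : nat) : seq T :=
  cone P n (E (stage (fun k m => size (cone P m (E k))) n)).

Lemma eq_slow_cone (T : eqType) (P Q : T -> nat -> seq T) (E : nat -> seq T) :
  (forall k, {in E k, P =1 Q}) -> slow_cone P E = slow_cone Q E.
Proof.
move=> PQ; have PQE k m : cone P m (E k) = cone Q m (E k).
  exact: eq_in_cone.
apply/funext => n; rewrite /slow_cone PQE; congr (cone _ _ (E (stage _ _))).
by apply/funext => k; apply/funext => m; rewrite PQE.
Qed.

(** When the selected stage is 0 the inequality [stage_le] says nothing, hence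
    the requirement that the exhaustion start with the empty sequence. *)
Lemma size_slow_cone (T : eqType) (P : T -> nat -> seq T) (E : nat -> seq T)
    (n : nat) :
  E 0%N = [::] -> (size (slow_cone P E n) <= n)%N.
Proof.
move=> E0; have := stage_le (fun k m => size (cone P m (E k))) n.
rewrite /slow_cone; case: (stage _ n) => [|k]; first by rewrite E0.
exact: leq_trans (leq_pmull _ _).
Qed.

Lemma sublinear_slow_cone (T : eqType) (P : T -> nat -> seq T)
    (E : nat -> seq T) :
  (forall k, {in E k, forall x, sublinear (fun n => size (P x n))}) ->
  sublinear (fun n => size (slow_cone P E n)).
Proof.
move=> Pslow c.
have [N PN] := stage_unbounded (fun k m => size (cone P m (E k))) c
  (sublinear_cone _ _ _ (Pslow c)).
exists N => n /PN cst.
apply: leq_trans (stage_le (fun k m => size (cone P m (E k))) n).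
by rewrite leq_mul2r cst orbT.
Qed.

Lemma mem_slow_cone (T : eqType) (P : T -> nat -> seq T) (E : nat -> seq T)
    (k : nat) (x : T) :
  (forall j, {in E j, forall y, sublinear (fun n => size (P y n))}) ->
  (forall m, (k <= m)%N -> x \in E m) ->
  exists N, forall n, (N <= n)%N -> x \in slow_cone P E n.
Proof.
move=> Pslow Ek.
have [N PN] := stage_unbounded (fun j m => size (cone P m (E j))) k
  (sublinear_cone _ _ _ (Pslow k)).
exists N => n /PN kst; rewrite mem_cone; apply/hasP.
by exists x; [exact: Ek | rewrite eqxx].
Qed.

(** * Recursion along a well-order *)

Lemma well_order_min {d : Order.disp_t} {W : orderType d} (A : set W) :
  well_order (<=%O : rel W) -> A !=set0 ->
  exists2 m, A m & forall x, A x -> m <= x.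
Proof.
move=> Wwo [a Aa]; pose B : {pred W} := fun x => `[< A x >].
have [|m [[/asboolP Am mlb] _]] := Wwo B; first by exists a; apply/asboolP.
by exists m => // x Ax; apply: mlb; apply/asboolP.
Qed.

Lemma well_order_wf {d : Order.disp_t} {W : orderType d} :
  well_order (<=%O : rel W) -> well_founded (fun x y : W => x < y).
Proof.
move=> Wwo x; apply: contrapT => xN.
have [|m mN mlb] := well_order_min [set y | ~ Acc (fun u v => u < v) y] Wwo.
  by exists x.
apply: mN; constructor => y ym; apply: contrapT => /mlb.
by rewrite leNgt ym.
Qed.

(** The step is a function of total maps [W -> X], with locality as a
    hypothesis, so that no proof of [y < a] has to be carried around; [x0] is
    the junk value fed to it at and above the current point. *)
Lemma well_order_recursion {d : Order.disp_t} {W : orderType d} {X : Type}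
    (x0 : X) (step : W -> (W -> X) -> X) :
  well_order (<=%O : rel W) ->
  (forall a f g, (forall y, y < a -> f y = g y) -> step a f = step a g) ->
  exists P : W -> X, forall a, P a = step a P.
Proof.
move=> /well_order_wf Wwf step_loc.
pose rec (a : W) (f : forall y, y < a -> X) :=
  step a (fun y => if pselect (y < a) is left h then f y h else x0).
exists (Fix Wwf (fun=> X) rec) => a; rewrite Fix_eq => [|b f g fg].
  by apply: step_loc => y ya; case: pselect.
by apply: step_loc => y _; case: pselect.
Qed.

(** * Transitive finite approximations of initial segments *)

Lemma countable_exhaustion {T : choiceType} (A : set T) :
  countable A -> exists E : nat -> seq T,
    [/\ E 0%N = [::], forall k x, x \in E k -> A x &
        forall x, A x -> exists k, forall m, (k <= m)%N -> x \in E m].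
Proof.
move=> /countable_injP[f finj].
pose o i := if pselect (exists x, A x /\ f x = i) is left h
  then Some (projT1 (cid h)) else None.
exists (fun k => pmap o (iota 0 k)); split => //.
  move=> k x; rewrite mem_pmap => /mapP[i _]; rewrite /o.
  by case: pselect => // h [->]; case: cid => /= y [].
move=> x Ax; exists (f x).+1 => m xm; rewrite mem_pmap; apply/mapP.
exists (f x); first by rewrite mem_iota.
rewrite /o; case: pselect => [h|[]]; last by exists x.
by case: cid => /= y [Ay /finj ->] //; rewrite inE.
Qed.

(** The recursion sends the map on [0,a) to [slow_cone] along an exhaustion of
    [0,a). The stages are not monotone in [n], so the sets [P a n] need not
    increase with [n]: eventual membership takes the place of monotonicity. *)
Lemma transitive_approximation {d : Order.disp_t} {W : orderType d} :
  is_omega1 W -> exists P : W -> nat -> seq W,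
    [/\ forall a n x, x \in P a n -> x < a,
        forall a x, x < a -> exists N, forall n, (N <= n)%N -> x \in P a n,
        forall a n x, x \in P a n -> {subset P x n <= P a n} &
        forall a n, (size (P a n) <= n)%N].
Proof.
move=> [Wwo _ Wseg].
have [E EP] := choice (fun a => countable_exhaustion _ (Wseg a)).
have E0 a : E a 0%N = [::] by have [] := EP a.
have Elt a k x : x \in E a k -> x < a by have [_ h _] := EP a; exact: h.
have Eall a x : x < a -> exists k, forall m, (k <= m)%N -> x \in E a m.
  by have [_ _] := EP a; apply.
have [|P PE] :=
    well_order_recursion (fun=> [::]) (fun a P => slow_cone P (E a)) Wwo.
  by move=> a f g fg; apply: eq_slow_cone => k x /Elt /fg.
have Plt a n x : x \in P a n -> x < a.
  elim/(well_founded_ind (well_order_wf Wwo)): a x => a IHa x.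
  rewrite PE mem_cone => /hasP[z /Elt za /orP[/eqP->//|xz]].
  exact: lt_trans (IHa _ za _ xz) za.
have Psub a n x : x \in P a n -> {subset P x n <= P a n}.
  elim/(well_founded_ind (well_order_wf Wwo)): a x => a IHa x.
  rewrite PE mem_cone => /hasP[z zE xz] y yx.
  rewrite mem_cone; apply/hasP; exists z => //.
  case/orP: xz => [/eqP zx|xz]; first by rewrite -zx yx orbT.
  by rewrite (IHa _ (Elt _ _ _ zE) _ xz _ yx) orbT.
have Pslow a : sublinear (fun n => size (P a n)).
  elim/(well_founded_ind (well_order_wf Wwo)): a => a IHa.
  by rewrite PE; apply: sublinear_slow_cone => k x /Elt; exact: IHa.
exists P; split=> // [a x /Eall[k Ek]|a n]; rewrite PE.
  by apply: mem_slow_cone Ek => j y _; exact: Pslow.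
exact: size_slow_cone.
Qed.

(** * The product topology on the power set *)

Lemma nbhs_ptwsP (T : choiceType) (f : {ptws T -> bool})
    (U : set {ptws T -> bool}) :
  nbhs f U <-> exists s : seq T, forall g, {in s, g =1 f} -> U g.
Proof.
(* The right-hand side defines a filter; the direct implication says that it
   converges to [f], which can be tested on each coordinate. *)
pose F : set_system {ptws T -> bool} :=
  [set U | exists s : seq T, forall g, {in s, g =1 f} -> U g].
have FF : Filter F.
  split.
  - by exists [::].
  - move=> A B [s sA] [t tB]; exists (s ++ t) => g gf; split.
      by apply: sA => x xs; apply: gf; rewrite mem_cat xs.
    by apply: tB => x xs; apply: gf; rewrite mem_cat xs orbT.
  - by move=> A B AB [s sA]; exists s => g /sA /AB.
split.
  suff : F --> f by exact.
  apply/cvg_sup => x A /= [_ [[B _ <-] Bfx] BA].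
  by exists [:: x] => g gf; apply: BA; rewrite /= gf ?mem_head.
move=> [s]; elim: s U => [|x s IHs] U sU.
  by apply: filterS filterT => g _; exact: sU.
have fx : nbhs f [set g : {ptws T -> bool} | g x = f x].
  have := @proj_continuous T (fun=> bool) x f [set f x].
  by apply; exact: discrete_set1.
have fs := IHs [set g : {ptws T -> bool} | {in s, g =1 f}] (fun _ => id).
apply: filterS (filterI fx fs) => g [/= gx gs]; apply: sU => y; rewrite inE.
by case/orP => [/eqP->|/gs].
Qed.

Lemma nbhs_agree (T : choiceType) (f : {ptws T -> bool}) (s : seq T) :
  nbhs f [set g : {ptws T -> bool} | {in s, g =1 f}].
Proof. by apply/nbhs_ptwsP; exists s. Qed.

Lemma isolated_agree (T : choiceType) (L : set {ptws T -> bool})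
    (g : {ptws T -> bool}) (s : seq T) :
  L g -> (forall h, L h -> {in s, h =1 g} -> h = g) -> isolated L g.
Proof.
move=> Lg gE; split; first by rewrite inE.
exists [set h : {ptws T -> bool} | {in s, h =1 g}]; first exact: nbhs_agree.
by apply/seteqP; split => [h [hg Lh]|_ ->]; [exact: gE | split].
Qed.

Lemma closure_ptwsP (T : choiceType) (F : set (set T))
    (f : {ptws T -> bool}) :
  closure [set char A | A in F] f <->
  forall s : seq T, exists2 A, F A & {in s, char A =1 f}.
Proof.
split=> [clf s|Ff U /nbhs_ptwsP[s sU]].
  have /clf[_ [[A FA <-] Af]] := nbhs_agree _ f s.
  by exists A.
by have [A FA Af] := Ff s; exists (char A); split; [exists A | exact: sU].
Qed.

(** * Sets whose gaps bound their size *)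

(** The size of [f] is bounded through its duplicate-free lists of elements, so
    that each instance of the condition reads finitely many values of [f]; this
    makes the condition closed. *)
Definition gap_bounded {d : Order.disp_t} {W : orderType d}
    (N : W -> W -> nat) (f : W -> bool) : Prop :=
  forall b a (s : seq W), b < a -> f a -> ~~ f b -> uniq s -> all f s ->
    (size s <= N b a)%N.

Lemma gap_bounded_closure {d : Order.disp_t} {W : orderType d}
    (N : W -> W -> nat) (F : set (set W)) (f : {ptws W -> bool}) :
  (forall A, F A -> gap_bounded N (char A)) ->
  closure [set char A | A in F] f -> gap_bounded N f.
Proof.
move=> FN /closure_ptwsP Ff b a s ba fa fb us fs.
have [A FA Af] := Ff [:: b, a & s].
apply: (FN A FA b a) => //.
- by rewrite Af ?inE ?eqxx ?orbT.
- by rewrite Af ?inE ?eqxx.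
- by apply/allP => x xs; rewrite Af ?inE ?xs ?orbT // (allP fs).
Qed.

Lemma downward_closed_initseg {d : Order.disp_t} {W : orderType d}
    (A : set W) :
  well_order (<=%O : rel W) -> (forall b a, b < a -> A a -> A b) ->
  exists a : option W, A = initseg a.
Proof.
move=> Wwo Adown; have [AT|/existsNP[a Aa]] := pselect (forall x, A x).
  by exists None; apply/seteqP; split.
have [|m Am mmin] := well_order_min (~` A) Wwo; first by exists a.
exists (Some m); apply/seteqP; split=> x /= Ax.
  rewrite ltNge le_eqVlt; apply/negP => /orP[/eqP mx|mx].
    by apply: Am; rewrite mx.
  by apply: Am; exact: Adown mx Ax.
by apply: contrapT => /mmin; rewrite leNgt Ax.
Qed.

Lemma gap_bounded_infinite {d : Order.disp_t} {W : orderType d}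
    (N : W -> W -> nat) (A : set W) :
  gap_bounded N (char A) -> infinite_set A ->
  forall b a, b < a -> A a -> A b.
Proof.
move=> AN Ainf b a ba Aa; apply: contrapT => Ab.
have [B BA] := infinite_set_fset (N b a).+1 Ainf; apply/negP; rewrite -ltnNge.
rewrite ltnS; apply: AN ba _ _ (finmap.fset_uniq B) _.
- by rewrite /char inE.
- by apply/negP; rewrite /char inE.
- by apply/allP => x xB; rewrite /char inE; exact: BA.
Qed.

(** An element [g] of maximal size is determined, among the elements of [L]
    containing [a] and omitting [b], by containing the elements of [g], since
    any further element would contradict maximality. *)
Lemma isolated_gap {d : Order.disp_t} {W : orderType d} (N : W -> W -> nat)
    (L : set {ptws W -> bool}) (f : {ptws W -> bool}) (b a : W) :
  (forall g, L g -> gap_bounded N g) -> L f -> b < a -> f a -> ~~ f b ->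
  exists g, isolated L g.
Proof.
move=> LN Lf ba fa fb.
pose Q n := `[< exists g (s : seq W),
  [/\ L g, g a, ~~ g b & [/\ uniq s, all g s & size s = n]] >].
have Qex : exists n, Q n by exists 0%N; apply/asboolP; exists f, [::].
have Qle n : Q n -> (n <= N b a)%N.
  move=> /asboolP[g [s [Lg ga gb [us gs <-]]]].
  exact: LN Lg _ _ _ ba ga gb us gs.
case: (ex_maxnP Qex Qle) => m /asboolP[g [s [Lg ga gb [us gs sm]]]] mmax.
have sE h : L h -> {in [:: a, b & s], h =1 g} ->
    h = (fun x => x \in s) :> (W -> bool).
  move=> Lh hg; apply/funext => x; apply/idP/idP => [hx|xs]; last first.
    by rewrite hg ?(allP gs) // !inE xs !orbT.
  apply: contraT => xs; suff : (m < m)%N by rewrite ltnn.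
  apply: mmax; apply/asboolP; exists h, (x :: s); split => //=.
  - by rewrite hg ?inE ?eqxx.
  - by rewrite hg ?inE ?eqxx ?orbT.
  - split; rewrite ?xs ?sm ?hx //=.
    by apply/allP => y ys; rewrite hg ?inE ?ys ?orbT // (allP gs).
exists g; apply: (isolated_agree _ _ _ [:: a, b & s]) => // h Lh hg.
by rewrite (sE h Lh hg) -(sE g Lg).
Qed.

(** [L] consists of initial segments. If [m] is the least point omitted by some
    element of [L], then [0,m) is the only element of [L] omitting [m]. If no
    point is ever omitted, [L] is reduced to the whole set. *)
Lemma isolated_chain {d : Order.disp_t} {W : orderType d}
    (L : set {ptws W -> bool}) :
  well_order (<=%O : rel W) -> L !=set0 ->
  (forall f b a, L f -> b < a -> f a -> f b) ->
  exists g, isolated L g.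
Proof.
move=> Wwo [f0 Lf0] Ldown.
have [[a [f Lf fa]]|LT] := pselect (exists a, exists2 f, L f & ~~ f a).
  have [|m [g Lg gm] mmin] :=
    well_order_min [set a | exists2 f, L f & ~~ f a] Wwo.
    by exists a, f.
  have gE h : L h -> ~~ h m -> h = (fun x => x < m) :> (W -> bool).
    move=> Lh hm; apply/funext => x; have [xm|mx|->] := ltgtP x m.
    - apply: contraT => hx; have := mmin x.
      by rewrite leNgt xm; apply; exists h.
    - by apply: contraNF hm => hx; exact: Ldown Lh mx hx.
    - exact: negbTE.
  exists g; apply: (isolated_agree _ _ _ [:: m]) => // h Lh hg.
  by rewrite [RHS](gE g Lg gm) [LHS](gE h Lh) // hg // mem_head.
have LE h : L h -> h = (fun=> true) :> (W -> bool).
  move=> Lh; apply/funext => x; apply: contraT => hx.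
  by case: LT; exists x, h.
exists f0; apply: (isolated_agree _ _ _ [::]) => // h Lh _.
by rewrite (LE h Lh) (LE f0).
Qed.

Lemma gap_bounded_scattered {d : Order.disp_t} {W : orderType d}
    (N : W -> W -> nat) (K : set {ptws W -> bool}) :
  well_order (<=%O : rel W) -> (forall f, K f -> gap_bounded N f) ->
  scattered K.
Proof.
move=> Wwo KN D _ KD0; set L := K `&` D.
have LN f : L f -> gap_bounded N f by move=> [/KN].
have [[f [b [a [Lf ba fa fb]]]]|Ldown] := pselect (exists f b a,
    [/\ L f, b < a, f a & ~~ f b]); first exact: isolated_gap LN Lf ba fa fb.
apply: isolated_chain => // f b a Lf ba fa; apply: contraT => fb.
by case: Ldown; exists f, b, a.
Qed.

(** * The family *)

Lemma omega1_bounded {d : Order.disp_t} {W : orderType d} (s : seq W) :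
  is_omega1 W -> exists a, {in s, forall x, x < a}.
Proof.
move=> [_ Wunc Wseg]; apply: contrapT => sN; apply: Wunc.
have -> : [set: W] =
    \bigcup_(a in [set` s]) ([set x | x < a] `|` [set a])%classic.
  apply/seteqP; split=> // a _; apply: contrapT => aN; apply: sN.
  exists a => x xs; rewrite ltNge le_eqVlt; apply/negP => ax; apply: aN.
  exists x => //=; case/orP: ax => [/eqP->|ax]; [by right|by left].
apply: bigcup_countable.
  by apply/finite_set_countable/finite_seqP; exists s.
by move=> a _; rewrite -bigcup2E; apply: bigcup_countable => // -[|[|i]] _ /=.
Qed.

Theorem theoremB (d : Order.disp_t) (W : orderType d) (hW : is_omega1 W) :
  exists F : set (set W),
    (forall A, F A -> finite_set A) /\
    let K : set {ptws W -> bool} := closure [set char A | A in F] in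
    [/\ forall a : W, K (char [set a]),
        forall a : option W, K (char (initseg a)),
        forall A : set W, K (char A) -> infinite_set A ->
          exists a : option W, A = initseg a
      & scattered K].
Proof.
have [P [Plt Pall Psub Psize]] := transitive_approximation hW.
have [Wwo _ _] := hW.
have Nex (p : W * W) : exists n, p.1 < p.2 ->
    forall m, (n <= m)%N -> p.1 \in P p.2 m.
  have [/Pall[n nP]|pN] := boolP (p.1 < p.2); first by exists n.
  by exists 0%N.
have [N NP] := choice Nex.
pose F : set (set W) :=
  [set A | (exists a, A = [set a]) \/ (exists a n, A = [set` P a n])].
(* The successor covers the singletons, for which [N] may be 0. *)
have FN A : F A -> gap_bounded (fun b a => (N (b, a)).+1) (char A).
  move=> [[c ->]|[c [n ->]]] b a s ba Aa Ab us As.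
    apply: (@leq_trans (size [:: c])) => //; apply: uniq_leq_size us _.
    by move=> x /(allP As); rewrite /char inE => ->; rewrite mem_head.
  have aP : a \in P c n by move: Aa; rewrite /char inE.
  have bP : b \notin P c n by apply: contraNN Ab; rewrite /char inE.
  have sP : {subset s <= P c n} by move=> x /(allP As); rewrite /char inE.
  rewrite leqW //; apply: leq_trans (uniq_leq_size us sP) _.
  apply: leq_trans (Psize c n) _.
  rewrite leqNgt; apply: contra bP => /ltnW nN.
  exact: Psub aP _ (NP (b, a) ba _ nN).
exists F; split.
  move=> A [[a ->]|[a [n ->]]]; first exact: finite_set1.
  by apply/finite_seqP; exists (P a n).
move=> K; have KN f : K f -> gap_bounded (fun b a => (N (b, a)).+1) f.
  exact: gap_bounded_closure.
have Kinit a : K (char (initseg (Some a))).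
  apply/closure_ptwsP => s.
  have [n nP] : exists n, {in s, forall x, x < a -> x \in P a n}.
    exists (\max_(x <- s) N (x, a))%N => x xs xa.
    by apply: (NP (x, a) xa); exact: (leq_bigmax_seq x xs).
  exists [set` P a n]; first by right; exists a, n.
  move=> x xs; apply/idP/idP; rewrite /char !inE /=; first exact: Plt.
  exact: nP.
split.
- by move=> a; apply: subset_closure; exists [set a] => //; left; exists a.
- case=> [//|]; apply/closure_ptwsP => s; have [a sa] := omega1_bounded s hW.
  have /closure_ptwsP/(_ s)[A FA As] := Kinit a; exists A => // x xs.
  by rewrite As //; apply/idP/idP; rewrite /char !inE //= => _; exact: sa.
- move=> A /KN AN Ainf; apply: downward_closed_initseg Wwo _.
  exact: gap_bounded_infinite AN Ainf.
- exact: gap_bounded_scattered KN.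
Qed.
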